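(* Let $n\ge 3$ and let $B$ be a bicentric $n$-gon in the Euclidean plane with vertices $A_1,\dots,A_n$ and sides (lines) $a_1,\dots,a_n$, inscribed in a circle $K$ with center $M_K$ and radius $R_K$, and circumscribed around a circle $C$ with center $M_C$ and radius $R_C$. Let $d=|M_CM_K|$ be the distance between the centers of $C$ and $K$. For each $i$ let $M_i$ be the center of the excircle of $B$ that touches $a_{i-1},a_i,a_{i+1}$, i.e. the intersection point of the external angle bisectors of $B$ at $A_i$ and $A_{i+1}$. Then the points $M_1,\dots,M_n$ all lie on a circle $E$ such that the center $M_K$ of $K$ is the midpoint of the center $M_C$ of $C$ and the center $M_E$ of $E$, and the radius $R_E$ of $E$ is given by $$R_E=\frac{|R_K^2-d^2|}{R_C}.$$
   Context: Indices are read cyclically modulo $n$. For $n\ge3$, an $n$-gon consists of $n$ points (vertices) $A_1,\dots,A_n$ and $n$ straight lines (sides) $a_1,\dots,a_n$ in the Euclidean plane such that for each $i$: $A_i$ and $A_{i+1}$ are distinct and lie on $a_i$; and $a_i$ and $a_{i+1}$ are distinct and meet in $A_{i+1}$. Polygons may be non-convex and self-intersecting, and the sides are full lines, not just segments. The polygon is inscribed in a circle $K$ (its circumcircle) if all vertices lie on $K$. It is circumscribed around a circle $C$ (its inscribed circle) if all sides, as lines, are tangent to $C$. It is bicentric if it has both a circumcircle $K$ and an inscribed circle $C$. There is no assumption that $C$ lies inside $K$; the circles $C$ and $K$ may intersect, or $C$ may lie outside $K$. At every vertex $A_i$ of a bicentric polygon there are two mutually orthogonal angle bisectors of the lines $a_{i-1}$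 and $a_i$. The one passing through the center $M_C$ of $C$ is called the internal angle bisector at $A_i$, the other one is called the external angle bisector at $A_i$. The external angle bisectors at the adjacent vertices $A_i,A_{i+1}$ meet in a point $M_i$, which is the center of the circle touching $a_{i-1},a_i,a_{i+1}$ called the excircle belonging to $a_i$. The circles $K$ and $C$ have positive radius. In the degenerate case $d=R_K$ the circle $E$ is understood as a circle of radius $0$, i.e. a single point. *)

(* Defs.v *)
From mathcomp Require Import all_boot all_order all_algebra.
From mathcomp Require Import boolp classical_sets reals.

(* The Euclidean plane is 'rV[R]_2 over R : realType. *)

Set Implicit Arguments.
Unset Strict Implicit.
Unset Printing Implicit Defensive.
Import Order.TTheory GRing.Theory Num.Theory.
Local Open Scope classical_set_scope.
Local Open Scope ring_scope.

Section Plane.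
Variable R : realType.
Local Notation point := 'rV[R]_2.
Implicit Types (P Q u v : point) (a b l : set point).

(* The norm that MathComp-Analysis puts on 'rV[R]_2 is the sup norm, hence the
   explicit Euclidean one here. *)
Definition dot u v : R := (u *m v^T) 0 0.
Definition enorm u : R := Num.sqrt (dot u u).
Definition dist P Q : R := enorm (P - Q).
Definition midpoint P Q : point := 2^-1 *: (P + Q).

(* A genuine line only if u != 0. *)
Definition line_through P u : set point := [set P + t *: u | t in [set: R]].
Definition is_line l : Prop := exists P u, u != 0 /\ l = line_through P u.

(* For r = 0 this is the single point P. *)
Definition circle P (r : R) : set point := [set Q | dist Q P = r].

Definition tangent l (c : set point) : Prop := exists T, l `&` c = [set T].

(* Meant for distinct lines a, b meeting in P: unit direction vectors u of a and
   v of b are determined up to sign, and the sign choices yield exactly the two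
   (mutually orthogonal) bisectors, with directions +-(u + v) and +-(u - v). *)
Definition angle_bisector a b l : Prop :=
  exists P u v, [/\ enorm u = 1 /\ enorm v = 1,
    a = line_through P u, b = line_through P v & l = line_through P (u + v)].

End Plane.

Section Polygon.
Variables (R : realType) (n : nat).
Local Notation point := 'rV[R]_2.
Implicit Types (A : 'I_n -> point) (a : 'I_n -> set point).

(* Indices are cyclic: ordS i is i + 1 and ord_pred i is i - 1 modulo n. *)
Definition polygon A a : Prop :=
  (forall i, is_line (a i)) /\
  (forall i, [/\ A i != A (ordS i), a i (A i), a i (A (ordS i)),
     a i <> a (ordS i) & a i `&` a (ordS i) = [set A (ordS i)]]).

Definition inscribed A (K : set point) : Prop := forall i, K (A i).

Definition circumscribed a (C : set point) : Prop := forall i, tangent (a i) C.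

Definition internal_bisector a (MC : point) (i : 'I_n) (l : set point) : Prop :=
  angle_bisector (a (ord_pred i)) (a i) l /\ l MC.

Definition external_bisector a (MC : point) (i : 'I_n) (l : set point) : Prop :=
  angle_bisector (a (ord_pred i)) (a i) l /\ ~ internal_bisector a MC i l.

(* P is the center of the excircle belonging to a_i. *)
Definition excenter a (MC : point) (i : 'I_n) (P : point) : Prop :=
  exists l m, [/\ external_bisector a MC i l,
    external_bisector a MC (ordS i) m & (l `&` m) P].

End Polygon.

(* Main.v *)
(* An external bisector is orthogonal to the line joining its vertex to M_C, so,
   with M_C as origin, M_i . A = |A|^2 for both end points A of the side a_i.
   Since |A - M_K| = R_K, the vector X = M_i - 2 M_K satisfies
   X . A = R_K^2 - d^2 at both end points. Hence X is normal to a_i, and as a_i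
   is at distance R_C from M_C, |X| R_C = |R_K^2 - d^2|. *)
Require Import Defs.
From mathcomp Require Import all_boot all_order all_algebra.
From mathcomp Require Import boolp classical_sets reals.
From mathcomp Require Import ring lra.
Import Order.TTheory GRing.Theory Num.Theory.
Local Open Scope classical_set_scope.
Local Open Scope ring_scope.

Section PlaneLemmas.
Set Implicit Arguments.
Unset Strict Implicit.
Context {R : realType}.
Local Notation point := 'rV[R]_2.
Implicit Types (P Q T u v w x : point) (a b l : set point) (r t : R).

(** The 2 by 2 determinant: for a unit vector [u], [cross u (Q - P)] is the signed distance from [Q]
    to the line through [P] directed by [u]. *)
Definition cross u v : R := u 0 0 * v 0 1 - u 0 1 * v 0 0.

Lemma dotE u v : dot u v = u 0 0 * v 0 0 + u 0 1 * v 0 1.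
Proof.
rewrite /dot mxE big_ord_recl big_ord1 !mxE.
by rewrite (_ : lift ord0 ord0 = 1) //; apply/val_inj.
Qed.

Lemma dot_ge0 u : 0 <= dot u u.
Proof. by rewrite dotE addr_ge0 // -expr2 sqr_ge0. Qed.

Lemma row2_eq u v : u 0 0 = v 0 0 -> u 0 1 = v 0 1 -> u = v.
Proof.
move=> h0 h1; apply/rowP => -[[|[|//]] i2].
  by rewrite (_ : Ordinal i2 = 0) //; apply/val_inj.
by rewrite (_ : Ordinal i2 = 1) //; apply/val_inj.
Qed.

Lemma enorm_sqr u : enorm u ^+ 2 = dot u u.
Proof. by rewrite sqr_sqrtr ?dot_ge0. Qed.

Lemma enorm_eq u r : 0 <= r -> (enorm u = r) <-> (dot u u = r ^+ 2).
Proof.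
move=> r0; split=> [<-|h]; first by rewrite enorm_sqr.
by rewrite /enorm h sqrtr_sqr ger0_norm.
Qed.

Lemma unit_dot u : enorm u = 1 -> dot u u = 1.
Proof. by move=> h; rewrite -enorm_sqr h expr1n. Qed.

Lemma mem_line_base P u : line_through P u P.
Proof. by exists 0 => //; rewrite scale0r addr0. Qed.

(** Since [u] and its quarter turn form an orthonormal basis, [dot u] and [cross u] are the
    coordinates in it. *)
Lemma dot_unit_frame u v w : enorm u = 1 ->
  dot v w = dot u v * dot u w + cross u v * cross u w.
Proof.
move=> /unit_dot; rewrite !dotE /cross => h.
transitivity ((u 0 0 * u 0 0 + u 0 1 * u 0 1) *
              (v 0 0 * w 0 0 + v 0 1 * w 0 1)); first by rewrite h mul1r.
by ring.
Qed.

Lemma mem_line_cross P Q u : u != 0 -> cross u (Q - P) = 0 ->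
  line_through P u Q.
Proof.
move=> u0 h; have uu : dot u u != 0.
  apply: contra u0 => /eqP; rewrite dotE => /eqP.
  rewrite paddr_eq0 -?expr2 ?sqr_ge0 // !sqrf_eq0 => /andP[/eqP h0 /eqP h1].
  by apply/eqP/row2_eq; rewrite mxE.
(* This is the parameter of the orthogonal projection of [Q] to the line; the vanishing [cross]
   makes [Q] its own projection. *)
exists (dot u (Q - P) / dot u u) => //.
move: h uu; rewrite /cross !dotE !mxE => h uu.
have e0 : (u 0 0 * (Q 0 0 - P 0 0) + u 0 1 * (Q 0 1 - P 0 1)) * u 0 0
  = (Q 0 0 - P 0 0) * (u 0 0 * u 0 0 + u 0 1 * u 0 1).
  by rewrite -[RHS]addr0 -(mulr0 (u 0 1)) -h; ring.
have e1 : (u 0 0 * (Q 0 0 - P 0 0) + u 0 1 * (Q 0 1 - P 0 1)) * u 0 1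
  = (Q 0 1 - P 0 1) * (u 0 0 * u 0 0 + u 0 1 * u 0 1).
  by rewrite -[RHS]subr0 -(mulr0 (u 0 0)) -h; ring.
by apply: row2_eq; rewrite !mxE mulrAC ?e0 ?e1 mulfK // addrC subrK.
Qed.

(* The symmetry of the line about the foot of the perpendicular from Q preserves
   the circle, so the unique contact point is that foot. *)
Lemma tangent_cross P Q u r : enorm u = 1 -> 0 <= r ->
  tangent (line_through P u) (circle Q r) -> cross u (Q - P) ^+ 2 = r ^+ 2.
Proof.
move=> u1 r0 [T hT].
have uu := unit_dot u1.
have dZ k : dot u (k *: u) = k.
  by rewrite -[RHS]mulr1 -uu !dotE !mxE; ring.
have normE k : dot (P + k *: u - Q) (P + k *: u - Q) =
    (k - dot u (Q - P)) ^+ 2 + cross u (Q - P) ^+ 2.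
  rewrite (dot_unit_frame _ _ u1).
  have -> : dot u (P + k *: u - Q) = k - dot u (Q - P).
    by rewrite -{2}(dZ k) !dotE !mxE; ring.
  by rewrite /cross !mxE; ring.
have [[t _ tT] /(enorm_eq _ r0)] : (line_through P u `&` circle Q r) T.
  by rewrite hT.
rewrite -tT normE => cT.
pose s := dot u (Q - P) *+ 2 - t.
have : (line_through P u `&` circle Q r) (P + s *: u).
  split; first by exists s.
  by apply/(enorm_eq _ r0); rewrite normE -cT /s; ring.
rewrite hT -tT => /addrI /(congr1 (dot u)); rewrite !dZ /s => st.
have tE : t = dot u (Q - P) by lra.
by rewrite -cT tE subrr expr0n add0r.
Qed.

(** Tangency puts [Q] at the same distance from both lines, so the product of the [cross] of [u + v]
    and of [v - u] with [Q - A], a difference of squares, is zero. As [l] misses [Q], the first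
    factor is nonzero. So [Q - A] is parallel to [v - u], which is orthogonal to [u + v] because [u]
    and [v] have equal length. *)
Lemma external_bisector_orth a b l A Q P r : 0 <= r ->
  tangent a (circle Q r) -> tangent b (circle Q r) ->
  a `&` b = [set A] -> a <> b ->
  angle_bisector a b l -> ~ l Q -> l P -> dot (P - A) (Q - A) = 0.
Proof.
move=> r0 ta tb abA neq [A' [u [v [[u1 v1] ea eb ->]]]] lQ [t _ <-].
have AA : A' = A.
  suff : (a `&` b) A' by rewrite abA.
  by rewrite ea eb; split; exact: mem_line_base.
subst A'; rewrite addrC addKr.
have uv0 : u + v != 0.
  apply/eqP => /eqP; rewrite addr_eq0 => /eqP uv; apply: neq.
  rewrite ea eb uv; apply/seteqP; split=> x [s _ <-];
    by exists (- s) => //; rewrite scaleNr scalerN ?opprK.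
have vu0 : v - u != 0.
  by apply/eqP => /eqP; rewrite subr_eq0 => /eqP uv; apply: neq; rewrite ea eb uv.
have cp : cross (u + v) (Q - A) != 0.
  by apply/eqP => /(mem_line_cross uv0).
have cu := @tangent_cross A Q u r u1 r0; rewrite -ea in cu.
have cv := @tangent_cross A Q v r v1 r0; rewrite -eb in cv.
have cm : cross (v - u) (Q - A) = 0.
  apply: (mulfI cp); rewrite mulr0.
  transitivity (cross v (Q - A) ^+ 2 - cross u (Q - A) ^+ 2).
    by rewrite /cross !mxE; ring.
  by rewrite (cu ta) (cv tb) subrr.
have [k _ /eqP] := mem_line_cross vu0 cm.
rewrite addrC -eq_sym -subr_eq => /eqP ->.
transitivity (t * k * (dot v v - dot u u)); first by rewrite !dotE !mxE; ring.
by rewrite (unit_dot u1) (unit_dot v1) subrr mulr0.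
Qed.

Lemma dist_excenter A B u K Q P rK r : enorm u = 1 -> 0 < r ->
  line_through A u B -> A != B -> cross u (Q - A) ^+ 2 = r ^+ 2 ->
  dist A K = rK -> dist B K = rK ->
  dot (P - A) (Q - A) = 0 -> dot (P - B) (Q - B) = 0 ->
  dist P (2 *: K - Q) = `|rK ^+ 2 - dist Q K ^+ 2| / r.
Proof.
move=> u1 r0 [t _ AB] neq cr KA KB PA PB.
set x := P - (2 *: K - Q).
(* Upon expansion, [dot x (T - Q)] is |T - K|^2 - |Q - K|^2 minus the product assumed to vanish. *)
have xp T : dist T K = rK -> dot (P - T) (Q - T) = 0 ->
    dot x (T - Q) = rK ^+ 2 - dist Q K ^+ 2.
  move=> <-; rewrite /dist !enorm_sqr /x !dotE !mxE => h.
  by rewrite -[RHS]subr0 -h; ring.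
(* [x] has the same product with [A - Q] and [B - Q], hence is orthogonal to [B - A], a nonzero
   multiple of [u]. *)
have xu : dot u x = 0.
  have t0 : t != 0.
    by apply: contra neq => /eqP t0; rewrite -AB t0 scale0r addr0.
  apply: (mulfI t0); rewrite mulr0.
  transitivity (dot x (B - Q) - dot x (A - Q)).
    by rewrite -AB !dotE !mxE; ring.
  by rewrite !xp // subrr.
(* In the frame of [u] only the [cross] coordinate of [x] survives, and that of [A - Q] is [r] up to
   sign. *)
have sq : dot x x * r ^+ 2 = (rK ^+ 2 - dist Q K ^+ 2) ^+ 2.
  rewrite -(xp A KA PA) -cr !(dot_unit_frame x _ u1) xu.
  by rewrite /cross !mxE; ring.
apply/enorm_eq; first by rewrite divr_ge0 // ltW.
by rewrite expr_div_n real_normK ?num_real // -sq mulfK // expf_neq0 // gt_eqF.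
Qed.

End PlaneLemmas.

Theorem theorem1 (R : realType) (n : nat) (hn : (3 <= n)%N)
  (A : 'I_n -> 'rV[R]_2) (a : 'I_n -> set 'rV[R]_2)
  (MK MC : 'rV[R]_2) (RK RC : R) (M : 'I_n -> 'rV[R]_2)
  (hB : polygon A a)
  (hRK : 0 < RK) (hRC : 0 < RC)
  (hK : inscribed A (circle MK RK))
  (hC : circumscribed a (circle MC RC))
  (hM : forall i, excenter a MC i (M i)) :
  let d := dist MC MK in
  exists (ME : 'rV[R]_2) (RE : R),
    [/\ MK = midpoint MC ME,
        RE = `|RK ^+ 2 - d ^+ 2| / RC
      & forall i, circle ME RE (M i)].
Proof.
(* The midpoint condition forces the center: the reflection of [MC] in [MK]. *)
move=> d; exists (2 *: MK - MC), (`|RK ^+ 2 - d ^+ 2| / RC); split=> // [|i].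
  by rewrite /midpoint addrC subrK scalerA mulVf ?scale1r // pnatr_eq0.
have orth j P l : external_bisector a MC j l -> l P ->
    dot (P - A j) (MC - A j) = 0.
  (* The sides meeting in [A j] have indices [ord_pred j] and [j], so the polygon condition is taken
     at [ord_pred j]. *)
  move=> [bis ext]; have [_ _ _ neq int] := hB.2 (ord_pred j).
  rewrite ord_predK in neq int.
  have lMC : ~ l MC by move=> lMC; apply: ext.
  exact: external_bisector_orth (ltW hRC) (hC _) (hC _) int neq bis lMC.
have [l [m [el em [lM mM]]]] := hM i.
have [neq Ai Ai' _ _] := hB.2 i.
(* The bisector at [A i] supplies a unit direction of [a i]; its base point is then moved to
   [A i]. *)
have [[P [_ [u [[_ u1] _ ea _]]]] _] := el.
have ua : a i = line_through (A i) u.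
  move: Ai; rewrite ea => -[s _ <-]; apply/seteqP; split=> x [t _ <-].
    by exists (t - s) => //; rewrite -addrA -scalerDl [s + _]addrC subrK.
  by exists (s + t) => //; rewrite scalerDl addrA.
apply: (@dist_excenter _ (A i) (A (ordS i)) u _ _ _ RK RC u1 hRC) => //.
- by rewrite -ua.
- by apply: tangent_cross => //; [exact: ltW | rewrite -ua].
- exact: hK.
- exact: hK.
- exact: orth el lM.
- exact: orth em mM.
Qed.
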